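(* For each $n\ge 1$, let $M$ be chosen uniformly at random from the set of all friendly symmetric $2n\times 2n$ matrices with entries in $\{0,1,\ast\}$ having exactly $n$ diagonal entries equal to $0$ and exactly $n$ diagonal entries equal to $1$. Then the probability that $M$ has infinitely many minimal obstructions tends to $1$ as $n\to\infty$.
   Context: All graphs are finite and simple. Let $M$ be a symmetric $m\times m$ matrix with entries in $\{0,1,\ast\}$ and no $\ast$ on the diagonal. A graph $G$ has an $M$-partition if $V(G)$ can be partitioned into $m$ (possibly empty) classes $C_1,\dots,C_m$ such that for all $i,j$ (including $i=j$): if $M_{ij}=0$ then no two distinct vertices $u\in C_i$, $v\in C_j$ are joined by an edge, and if $M_{ij}=1$ then every two distinct vertices $u\in C_i$, $v\in C_j$ are joined by an edge (the entry $\ast$ places no restriction). A minimal obstruction for $M$ is a graph which has no $M$-partition but every proper induced subgraph of which has an $M$-partition; minimal obstructions are counted up to isomorphism. The matrix $M$ is friendly if there are no two distinct indices $i,j$ with $M_{ii}=M_{jj}$ and $M_{ij}=\ast$ (i.e. no principal $2\times 2$ submatrix equals $\begin{pmatrix}0&\ast\\ \ast&0\end{pmatrix}$ or $\begin{pmatrix}1&\ast\\ \ast&1\end{pmatrix}$). *)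

(* Defs.v *)
From mathcomp Require Import all_boot all_order all_algebra.
From mathcomp Require Import all_classical all_reals all_analysis.
Import numFieldNormedType.Exports.

Set Implicit Arguments.
Unset Strict Implicit.
Unset Printing Implicit Defensive.

Record sgraph := SGraph {
  vertex :> finType;
  adj : rel vertex;
  adj_sym : symmetric adj;
  adj_irrefl : irreflexive adj }.

Section InducedSubgraph.
Variables (G : sgraph) (A : {set G}).

Definition induced_adj : rel {x : G | x \in A} :=
  fun u v => adj (val u) (val v).

Lemma induced_adj_sym : symmetric induced_adj.
Proof. by move=> u v; apply: adj_sym. Qed.

Lemma induced_adj_irrefl : irreflexive induced_adj.
Proof. by move=> u; apply: adj_irrefl. Qed.

Definition induced : sgraph := SGraph induced_adj_sym induced_adj_irrefl.

End InducedSubgraph.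

Definition sgraph_iso (G H : sgraph) : Prop :=
  exists f : G -> H, bijective f /\ forall u v, adj (f u) (f v) = adj u v.

Notation entry := (option bool).
Notation e0 := (Some false).
Notation e1 := (Some true).
Notation estar := (@None bool).

Section Patterns.
Variables (m : nat) (M : 'M[entry]_m).

(* [c u] is the index of the class of [u]; a class is empty when [c] misses
   its index. *)
Definition has_partition (G : sgraph) : Prop :=
  exists c : G -> 'I_m, forall u v : G, u != v ->
    (M (c u) (c v) = e0 -> ~~ adj u v) /\ (M (c u) (c v) = e1 -> adj u v).

Definition minimal_obstruction (G : sgraph) : Prop :=
  ~ has_partition G /\
  forall A : {set G}, A \proper [set: G] -> has_partition (induced A).

(* No finite list of graphs represents every minimal obstruction up to
   isomorphism. *)
Definition infinitely_many_minimal_obstructions : Prop :=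
  ~ exists (k : nat) (F : 'I_k -> sgraph),
      forall G, minimal_obstruction G -> exists i, sgraph_iso G (F i).

Definition symmetric_pattern : bool := (M^T == M)%R.

Definition friendly : bool :=
  [forall i, forall j, ~~ [&& i != j, M i i == M j j & M i j == estar]].

Definition diag_count (e : entry) : nat := #|[set i | M i i == e]|.

End Patterns.

(* The diagonal counts add up to the dimension, so no [*] is on the diagonal. *)
Definition friendly_patterns (n : nat) : {set 'M[entry]_(2 * n)} :=
  [set M | [&& symmetric_pattern M, friendly M,
               diag_count M e0 == n & diag_count M e1 == n]].

Definition uniform_probability (R : realType) (T : finType) (A : {set T})
    (P : T -> Prop) : R :=
  (#|[set x in A | `[< P x >]]|%:R / #|A|%:R)%R.

(* Main.v *)
(* A pattern M with vertices p0, p1 on the 0-side and q0, q1 on the 1-side such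
   that M(p_i,q_i) = 0 and M(p_i,q_(1-i)) = * transmits a choice along a path
   x0 y0 x1 ... xN: if every x lies in {p0,p1} and every y in {q0,q1}, then
   x0 in p0 forces all x into p0.  Two further classes s0, s1 forbid xN in p0 and
   x0 in p1, so the path is an obstruction that disappears as soon as one of its
   vertices is deleted.  The lists {p0,p1} and {q0,q1} are imposed by a blow-up
   of a large set U of 0-diagonal classes, each seeing every one of the six
   special classes in a prescribed way; what is needed is that U embeds in M
   only as itself, and that no class outside the special ones sees U as one of
   them does.
   For random M there are about sqrt n disjoint candidates for the six special
   classes, and one of them carries the required pattern; independently, each of
   about sqrt n blocks of sqrt n classes contains a member of U.  Given the rows
   of the six classes, the rest of M is still uniform, and a union bound over the
   maps U -> M, weighted by the number of displaced points, gives the two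
   properties of U. *)
Require Import Defs.
From mathcomp Require Import all_boot all_order all_algebra.
From mathcomp Require Import all_classical all_reals all_analysis.
From mathcomp Require Import zify ring lra.
(* [Defs] is imported again because [charge] shadows [induced]. *)
Import Defs numFieldNormedType.Exports.
Import Order.TTheory GRing.Theory Num.Theory.

Set Implicit Arguments.
Unset Strict Implicit.
Unset Printing Implicit Defensive.

(** * Chains of unbounded length *)

Section Obstructions.
Variables (m : nat) (M : 'M[entry]_m).

Lemma has_partition_induced_induced (G : sgraph) (A : {set G})
    (B : {set induced A}) :
  has_partition M (induced [set val x | x in B]) -> has_partition M (induced B).
Proof.
case=> c cP.
have vP (w : induced B) : val (val w) \in [set val x | x in B].
  by apply: imset_f; exact: (valP w).
exists (fun w => c (exist _ (val (val w)) (vP w))) => x y xy.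
apply: (cP (exist _ (val (val x)) (vP x)) (exist _ (val (val y)) (vP y))).
by apply: contraNneq xy => /(congr1 val) /= /val_inj /val_inj ->.
Qed.

Lemma minimal_obstruction_exists (G : sgraph) :
  ~ has_partition M G ->
  exists A : {set G}, minimal_obstruction M (induced A).
Proof.
move=> nG.
have nT : `[< ~ has_partition M (induced [set: G]) >].
  apply/asboolP => -[c cP]; apply: nG.
  exists (fun x => c (exist _ x (finset.in_setT x))) => x y xy.
  by apply: (cP (exist _ x (finset.in_setT x)) (exist _ y (finset.in_setT y))).
case: (@arg_minnP _ [set: G]
  (fun A => `[< ~ has_partition M (induced A) >]) (fun A => #|A|) nT) => A.
move=> /asboolP nA minA; exists A; split=> // B /proper_card ltB.
apply: has_partition_induced_induced; apply: contrapT => nB.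
have /minA : `[< ~ has_partition M (induced [set val x | x in B]) >].
  exact/asboolP.
rewrite card_imset; last exact: val_inj.
by rewrite leqNgt; apply/negP; rewrite negbK; move: ltB; rewrite cardsT card_sig.
Qed.

(** A finite list would bound the size of minimal obstructions by some [N]. But a graph without a
    partition contains a minimal obstruction, and local partitions make it larger than [N]. *)
Lemma infinitely_many_minimal_obstructions_local :
  (forall N, exists G : sgraph, ~ has_partition M G /\
     forall A : {set G}, #|A| <= N -> has_partition M (induced A)) ->
  infinitely_many_minimal_obstructions M.
Proof.
move=> H [k [F FP]].
have [G [nG GP]] := H (\max_(i < k) #|F i|).
have [A minA] := minimal_obstruction_exists nG.
have [i [f [f_bij _]]] := FP _ minA.
case: minA => nA _; apply: nA; apply: GP.
have -> : #|A| = #|induced A| by rewrite card_sig.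
by rewrite (bij_eq_card f_bij); exact: (@leq_bigmax _ (fun i => #|F i|)).
Qed.

End Obstructions.

(* [inl b] is p_b, [inr (false, b)] is q_b and [inr (true, b)] is s_b. *)
Notation role := (bool + bool * bool)%type.

Definition role_diag (r : role) : bool := if r is inr _ then true else false.

Definition role_pattern (r r' : role) : entry :=
  match r, r' with
  | inl _, inl _ => e0
  | inl b, inr (_, b') => if b == b' then e0 else estar
  | inr (_, b'), inl b => if b == b' then e0 else estar
  | inr (c, _), inr (c', _) => Some (~~ (c || c'))
  end.

(* How the class of role [r] sees the members of [U] of colour [c]. *)
Definition profile (r : role) (c : bool) : bool :=
  match r with
  | inl _ => false
  | inr (false, _) => true
  | inr (true, b) => c (+) b
  end.

Lemma role_patternC r r' : role_pattern r r' = role_pattern r' r.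
Proof. by case: r => [b|[c b]]; case: r' => [b'|[c' b']] //=; rewrite orbC. Qed.

(** In the first clause an entry [*] counts as compatible, and the special class found may have a
    role other than [r]. In the second, [phi] need not be injective. *)
Definition rigid_lists (m k : nat) (M : 'M[entry]_m) (T : role -> 'I_m)
    (u : bool * 'I_k -> 'I_m) : Prop :=
  (forall r i, (forall g, M i (u g) <> Some (~~ profile r g.1)) ->
     exists r', i = T r') /\
  (forall phi : bool * 'I_k -> 'I_m,
     (forall g, M (phi g) (phi g) = e0) ->
     (forall g g', g != g' -> M (phi g) (phi g') = M (u g) (u g')) ->
     phi =1 u).

Definition framed (m k : nat) (M : 'M[entry]_m) (T : role -> 'I_m)
    (u : bool * 'I_k -> 'I_m) : Prop :=
  [/\ forall r r', r != r' -> M (T r) (T r') = role_pattern r r',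
      forall r, M (T r) (T r) = Some (role_diag r),
      forall g, M (u g) (u g) = e0 &
      forall r g, M (T r) (u g) = Some (profile r g.1)].

(** * The chain graph and its partitions *)

Section ChainGraph.
Variables (m k N : nat) (M : 'M[entry]_m) (T : role -> 'I_m).
Variable u : bool * 'I_k -> 'I_m.
Hypotheses (Msym : symmetric_pattern M) (Mfr : friendly M).
Hypothesis Mdiag : forall i, M i i != estar.

(** There are [m.+1] copies, one more than the number of classes, for a pigeonhole argument. The
    path has N + 1 vertices x and N vertices y. *)
Let chain_vertex : finType :=
  ((bool * 'I_k) * 'I_m.+1 + ('I_(N.*2.+1) + bool))%type.

(* [inl (g, a)] is the a-th copy of [u g]; the path vertex [t] is x_(t/2) for
   even [t] and y_(t/2) for odd [t]; [inr (inr b)] is meant to lie in s_b. *)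
Definition chain_adj (v w : chain_vertex) : bool :=
  match v, w with
  | inl (g, _), inl (g', _) => (g != g') && (M (u g) (u g') == e1)
  | inl _, inr (inl t) | inr (inl t), inl _ => odd t
  | inl (g, _), inr (inr b) | inr (inr b), inl (g, _) => g.1 (+) b
  | inr (inl t), inr (inl t') =>
      if odd t == odd t' then odd t && (t != t')
      else (t' == t.+1 :> nat) || (t == t'.+1 :> nat)
  | inr (inl t), inr (inr b) | inr (inr b), inr (inl t) =>
      t == (if b then 0 else N.*2) :> nat
  | inr (inr _), inr (inr _) => false
  end.

Lemma pattern_sym i j : M i j = M j i.
Proof. by move/eqP: Msym => {1}<-; rewrite mxE. Qed.

Lemma chain_adj_sym : symmetric chain_adj.
Proof.
move=> [[g a]|[t|b]] [[g' a']|[t'|b']] //=; first by rewrite eq_sym pattern_sym.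
rewrite (eq_sym (odd t)) (eq_sym t) orbC.
by case: ifP => // /eqP ->.
Qed.

Lemma chain_adj_irrefl : irreflexive chain_adj.
Proof. by move=> [[g a]|[t|b]] //=; rewrite ?eqxx ?andbF. Qed.

Definition chain_graph : sgraph := SGraph chain_adj_sym chain_adj_irrefl.

Hypothesis frame : framed M T u.

(** The missing vertex cuts the path: before it the x go to p_0 and the y to q_1, after it the x go
    to p_1 and the y to q_0. An x and a y on the same side meet an entry [*]; across the cut they
    meet 0 and are not joined. *)
Lemma chain_partition (A : {set chain_graph}) (t0 : 'I_(N.*2.+1)) :
  (inr (inl t0) : chain_graph) \notin A -> has_partition M (induced A).
Proof.
case: frame => MT MTd Mu MTu t0A.
pose c (v : chain_graph) : 'I_m := match v with
  | inl (g, _) => u g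
  | inr (inl t) => T (if odd t then inr (false, t < t0) else inl (t0 < t))
  | inr (inr b) => T (inr (true, b))
  end.
exists (fun v => c (val v)) => -[x xA] [y yA] xy.
have {xy}xy : x != y by apply: contraNneq xy => e; apply/eqP/val_inj.
rewrite /induced_adj /=.
have At0 (t : 'I_(N.*2.+1)) : (inr (inl t) : chain_graph) \in A -> t != t0 :> nat.
  by move=> tA; apply: contraNneq t0A => /val_inj <-.
have patt r r' a : r != r' ->
    (role_pattern r r' = e0 -> ~~ a) /\ (role_pattern r r' = e1 -> a) ->
    (M (T r) (T r') = e0 -> ~~ a) /\ (M (T r) (T r') = e1 -> a).
  by move=> /MT ->.
have prof r g a : profile r g.1 = a ->
    ((M (T r) (u g) = e0 -> ~~ a) /\ (M (T r) (u g) = e1 -> a)) /\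
    ((M (u g) (T r) = e0 -> ~~ a) /\ (M (u g) (T r) = e1 -> a)).
  by rewrite [M (u g) _]pattern_sym MTu => ->; case: a.
have noadj r r' : r != r' -> role_pattern r r' <> e1 ->
    (M (T r) (T r') = e0 -> ~~ false) /\ (M (T r) (T r') = e1 -> false).
  by move=> /MT ->.
have endpoint (t : 'I_(N.*2.+1)) b a : (inr (inl t) : chain_graph) \in A ->
    a = (t == (if b then 0 else N.*2) :> nat) ->
    let r := if odd t then inr (false, t < t0) else inl (t0 < t) in
    ((M (T r) (T (inr (true, b))) = e0 -> ~~ a) /\
     (M (T r) (T (inr (true, b))) = e1 -> a)) /\
    ((M (T (inr (true, b))) (T r) = e0 -> ~~ a) /\
     (M (T (inr (true, b))) (T r) = e1 -> a)).
  move=> tA -> r; rewrite [M (T (inr _)) _]pattern_sym.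
  suff : (M (T r) (T (inr (true, b))) = e0 ->
            ~~ (t == (if b then 0 else N.*2) :> nat)) /\
         M (T r) (T (inr (true, b))) <> e1.
    by case=> ? ne; split; split.
  have tt0 := At0 _ tA; have := ltn_ord t; have := ltn_ord t0.
  rewrite {}/r; have [ot|ot] := boolP (odd t); rewrite MT //=.
    by split=> // _; case: (b); apply: contraTneq ot => ->; rewrite ?odd_double.
  case: eqP => // <-; split=> // _; case: ltnP => ?; apply/eqP; lia.
case: x y xA yA xy => [[g a]|[t|b]] [[g' a']|[t'|b']] xA yA xy /=.
- have [<-|gg'] := eqVneq g g'; first by rewrite Mu.
  by case: (M (u g) (u g')) => [[]|].
- by apply: (prof _ _ _ _).2; case: (odd t').
- exact: (prof _ _ _ _).2.
- by apply: (prof _ _ _ _).1; case: (odd t).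
- have tt' : t != t' by apply: contraNneq xy => ->.
  move: (At0 _ xA) (At0 _ yA) => tt0 t't0.
  have [ot|ot] := boolP (odd t); have [ot'|ot'] := boolP (odd t') => /=.
  + rewrite tt'.
    have [->|ne] := eqVneq (t < t0) (t' < t0); first by rewrite MTd.
    by apply: patt => //=; apply: contra ne => /eqP[->].
  + apply: patt => //=; split; last by case: ifP.
    case: ifP => // /eqP e _; apply/negP => /orP[] /eqP tt1; lia.
  + apply: patt => //=; split; last by case: ifP.
    case: ifP => // /eqP e _; apply/negP => /orP[] /eqP tt1; lia.
  + have [->|ne] := eqVneq (t0 < t) (t0 < t'); first by rewrite MTd.
    by apply: noadj => //=; apply: contra ne => /eqP[->].
- exact: (endpoint _ _ _ xA _).1.
- exact: (prof _ _ _ _).1.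
- exact: (endpoint _ _ _ yA _).2.
- have [e|ne] := eqVneq b b'; first by move: xy; rewrite e eqxx.
  by apply: noadj => //=; apply: contra ne => /eqP[->].
Qed.

Hypotheses (k_gt0 : 0 < k) (MTu : rigid_lists M T u).

Lemma chain_no_partition : ~ has_partition M chain_graph.
Proof.
case: frame => MT MTd Mu MTup; case: MTu => lists rigid [c cP].
have [rep repP] : {rep : bool * 'I_k -> 'I_m.+1 |
    forall g, M (c (inl (g, rep g))) (c (inl (g, rep g))) = e0}.
  suff H g : {a | M (c (inl (g, a))) (c (inl (g, a))) = e0}.
    by exists (fun g => sval (H g)) => g; exact: svalP (H g).
  (* Two of the [m.+1] copies share a class, whose diagonal entry is then 0. *)
  have : ~~ injectiveb (fun a : 'I_m.+1 => c (inl (g, a))).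
    by apply/injectiveP => /leq_card; rewrite !card_ord ltnn.
  case/injectivePn/cid=> a /cid2[b ab cab]; exists a.
  have [_] := cP (inl (g, a)) (inl (g, b)) (ltac:(by apply: contra ab => /eqP[->])).
  rewrite -cab /= eqxx /=; move: (Mdiag (c (inl (g, a)))).
  by case: (M _ _) => [[_ /(_ erefl)|]|].
(* Friendliness excludes [*] between distinct classes of diagonal 0, so adjacency among the
   representatives determines the entries between their classes, and rigidity applies. *)
have repu g : c (inl (g, rep g)) = u g.
  move: g; apply: rigid => // g g' gg'.
  have := cP (inl (g, rep g)) (inl (g', rep g'))
    (ltac:(by apply: contra gg' => /eqP[->])).
  have nstar i j : i != j -> M i i = e0 -> M j j = e0 -> M i j <> estar.
    move=> ij ii jj e; move/forallP/(_ i)/forallP/(_ j): Mfr.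
    by rewrite ij ii jj e.
  rewrite /= gg' /=; have := nstar _ _ _ (Mu g) (Mu g').
  have := nstar _ _ _ (repP g) (repP g').
  have [ecc|_ /(_ isT)] := eqVneq (c (inl (g, rep g))) (c (inl (g', rep g'))).
    rewrite -ecc (repP g) => _.
    have [->|_ /(_ isT)] := eqVneq (u g) (u g'); first by rewrite Mu.
    by case: (M (u g) (u g')) => [[]|] // _ [/(_ erefl)].
  case: (M (c _) _) => [e|] // _.
  have [->|_ /(_ isT)] := eqVneq (u g) (u g').
    by rewrite Mu => _ [_]; case: e => // /(_ erefl).
  case: (M (u g) (u g')) => [[]|] // _ [];
    by case: e => // h0 h1; first [have := h0 erefl | have := h1 erefl].
(* The representatives occupy the classes [u g], so the class of [v] is compatible with [r], hence
   special. Since [k] is positive both colours occur, and the two profiles agree. *)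
have place r (v : 'I_(N.*2.+1) + bool) :
    (forall g, adj (inr v : chain_graph) (inl (g, rep g)) = profile r g.1) ->
    exists2 r', c (inr v) = T r' & profile r' =1 profile r.
  move=> adjv.
  have compat g : M (c (inr v)) (u g) <> Some (~~ profile r g.1).
    have [] := cP (inr v) (inl (g, rep g)) isT.
    by rewrite repu adjv; case: (profile r g.1) => /= h0 h1 e;
      [move: (h0 e)|move: (h1 e)].
  have [r' cr'] := lists r _ compat; exists r' => // b.
  have := compat (b, Ordinal k_gt0); rewrite cr' MTup /= => ne.
  by apply/eqP; apply: contra_notT ne; case: (profile r b); case: (profile r' b).
have placex (t : 'I_(N.*2.+1)) : ~~ odd t ->
    exists b, c (inr (inl t)) = T (inl b).
  move=> ot; have [|r ->] := place (inl false) (inl t).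
    by move=> g /=; rewrite (negbTE ot).
  case: r => [b _|[[] b]]; first by exists b.
    by move/(_ (~~ b)); case: b.
  by move/(_ true).
have placey (t : 'I_(N.*2.+1)) : odd t ->
    exists b, c (inr (inl t)) = T (inr (false, b)).
  move=> ot; have [|r ->] := place (inr (false, false)) (inl t).
    by move=> g /=; rewrite ot.
  case: r => [b|[[] b]]; first by move/(_ true).
    by move/(_ b); case: b.
  by exists b.
have placew b : c (inr (inr b)) = T (inr (true, b)).
  have [|r ->] := place (inr (true, b)) (inr b) => //.
  case: r => [b'|[[] b']].
  - by move/(_ (~~ b)); case: b.
  - by move/(_ false) => /= ->.
  - by move/(_ b); case: b.
(* The neighbour in s_1 keeps x_0 out of p_1. After an x in p_0, the next y must avoid q_0; it lies
   in q_1 and keeps the following x out of p_1. *)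
have low t (lt : t < N.*2.+1) : ~~ odd t ->
    c (inr (inl (Ordinal lt))) = T (inl false).
  elim/ltn_ind: t lt => t IH lt ot.
  have [[] cx] := placex (Ordinal lt) ot; rewrite cx //; exfalso.
  case: t => [|[|t]] // in IH lt ot cx *.
    have [+ _] := cP (inr (inl (Ordinal lt))) (inr (inr true)) isT.
    by rewrite cx placew MT //= => /(_ erefl).
  have lt1 : t.+1 < N.*2.+1 by exact: ltnW.
  have lt0 : t < N.*2.+1 by exact: ltnW.
  have ot0 : ~~ odd t by move: ot; rewrite /= negbK.
  have cx0 := IH t (ltnW (ltnSn _)) lt0 ot0.
  have [b cy] := placey (Ordinal lt1) ot0.
  have [+ _] := cP (inr (inl (Ordinal lt0))) (inr (inl (Ordinal lt1)))
    (ltac:(by apply/eqP => -[]; lia)).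
  rewrite cx0 cy MT //= (negbTE ot0) /= eqxx /=.
  case: b cy => [cy _|_ /(_ erefl)] //.
  have [+ _] := cP (inr (inl (Ordinal lt1))) (inr (inl (Ordinal lt)))
    (ltac:(by apply/eqP => -[]; lia)).
  by rewrite cx cy MT //= (negbTE ot0) /= eqxx /= => /(_ erefl).
have [+ _] := cP (inr (inl ord_max)) (inr (inr false)) isT.
by rewrite placew low ?odd_double // MT //= eqxx => /(_ erefl).
Qed.

End ChainGraph.

(** A set of at most [N] vertices misses one of the [N.*2.+1] path vertices, so [chain_partition]
    applies to it. *)
Lemma rigid_lists_infinite (m k : nat) (M : 'M[entry]_m) (T : role -> 'I_m)
    (u : bool * 'I_k -> 'I_m) :
  symmetric_pattern M -> friendly M -> (forall i, M i i != estar) -> 0 < k ->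
  framed M T u -> rigid_lists M T u -> infinitely_many_minimal_obstructions M.
Proof.
move=> Msym Mfr Mdiag k_gt0 frame MTu.
apply: infinitely_many_minimal_obstructions_local => N.
exists (chain_graph N u Msym); split.
  exact: (chain_no_partition (T := T)).
move=> A leA.
suff [t0 t0A] : exists t0 : 'I_(N.*2.+1), (inr (inl t0) : chain_graph N u Msym) \notin A.
  exact: chain_partition frame _ _ t0A.
apply: contrapT => /forallNP allA.
pose vert (t : 'I_(N.*2.+1)) : chain_graph N u Msym := inr (inl t).
have vert_inj : injective vert by move=> t t' [].
have sub : vert @: 'I_(N.*2.+1) \subset A.
  by apply/fintype.subsetP => _ /imsetP[t _ ->]; apply/negPn/negP; exact: allA.
have := leq_trans (subset_leq_card sub) leA.
by rewrite card_imset // card_ord ltnNge -addnn leq_addr.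
Qed.

(** * Uniform patterns with a given diagonal *)

Local Open Scope ring_scope.

Lemma sum_indicator (R : pzSemiRingType) (T : finType) (A : {set T}) (P : pred T) :
  \sum_(x in A) (P x)%:R = #|[set x in A | P x]|%:R :> R.
Proof.
rewrite -sum1_card natr_sum; under [RHS]eq_bigl do rewrite inE.
by rewrite big_mkcondr; apply: eq_bigr => x _; case: (P x).
Qed.

Section RandomPattern.
Variables (R : realType) (m : nat) (d : 'I_m -> bool).
Implicit Types (M N W : 'M[entry]_m) (B : {set 'I_m * 'I_m}).

(** With the diagonal fixed, a uniform member has independent entries above the diagonal: three
    values where the diagonal entries differ, only 0 and 1 where they agree. *)
Definition diag_patterns : {set 'M[entry]_m} :=
  [set M | [&& symmetric_pattern M, friendly M & [forall i, M i i == Some (d i)]]].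

Lemma diag_patternsP M :
  reflect [/\ forall i j, M i j = M j i, forall i, M i i = Some (d i) &
              forall i j, i != j -> d i = d j -> M i j != estar]
          (M \in diag_patterns).
Proof.
rewrite inE; apply: (iffP and3P) => [[sM fM /forallP dM]|[sM dM fM]]; split.
- by move=> i j; move/eqP: sM => {1}<-; rewrite mxE.
- by move=> i; apply/eqP.
- move=> i j ij dij; move/forallP/(_ i)/forallP/(_ j): fM.
  by rewrite ij (eqP (dM i)) (eqP (dM j)) dij eqxx.
- by apply/eqP/matrixP => i j; rewrite mxE.
- apply/forallP => i; apply/forallP => j; apply/negP => /and3P[ij].
  by rewrite !dM => /eqP[/(fM _ _ ij) /negP].
- by apply/forallP => i; rewrite dM.
Qed.

(** Turns a symmetric table of desired entries into an admissible pattern: the diagonal is imposed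
    and a forbidden [*] becomes 0. *)
Definition sym_target (t : 'I_m -> 'I_m -> entry) : 'M[entry]_m :=
  \matrix_(i, j) if i == j then Some (d i)
    else if (d i == d j) && (t i j == estar) then e0 else t i j.

Lemma sym_target_diag_patterns t :
  (forall i j, t i j = t j i) -> sym_target t \in diag_patterns.
Proof.
move=> tC; apply/diag_patternsP; split=> [i j|i|i j ij dij]; rewrite !mxE.
- by rewrite eq_sym [d i == _]eq_sym tC; case: eqP => // ->.
- by rewrite eqxx.
- by rewrite (negbTE ij) dij eqxx /=; case: (t i j).
Qed.

Lemma diag_patterns_gt0 : (0 < #|diag_patterns|)%N.
Proof.
apply/card_gt0P; exists (sym_target (fun _ _ => e0)).
exact: sym_target_diag_patterns.
Qed.

(** Models conditioning on the entries outside [B]: these come from [M], while those in [B] are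
    redrawn from an independent [N]. *)
Definition resample B M N : 'M[entry]_m :=
  \matrix_(i, j) if (i, j) \in B then N i j else M i j.

Definition cross (A C : {set 'I_m}) : {set 'I_m * 'I_m} :=
  [set p | (p.1 \in A) && (p.2 \in C) || (p.1 \in C) && (p.2 \in A)].

Lemma in_cross A C i j : ((i, j) \in cross A C) =
  (i \in A) && (j \in C) || (i \in C) && (j \in A).
Proof. by rewrite inE. Qed.

Lemma card_cross A C : (#|cross A C| <= 2 * (#|A| * #|C|))%N.
Proof.
have -> : cross A C = finset.setX A C :|: finset.setX C A.
  by apply/finset.setP => -[i j]; rewrite !inE.
by rewrite (leq_trans (leq_card_setU _ _)) // !cardsX [(#|C| * _)%N]mulnC mul2n -addnn.
Qed.

Lemma resample_diag_patterns A C M N :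
  M \in diag_patterns -> N \in diag_patterns ->
  resample (cross A C) M N \in diag_patterns.
Proof.
move=> /diag_patternsP[sM dM fM] /diag_patternsP[sN dN fN].
apply/diag_patternsP; split=> [i j|i|i j ij dij]; rewrite !mxE.
- by rewrite !in_cross orbC andbC [X in _ || X]andbC sM sN.
- by case: ifP.
- by case: ifP; [rewrite fN|rewrite fM].
Qed.

Lemma resampleK B M N : resample B (resample B M N) (resample B N M) = M.
Proof. by apply/matrixP => i j; rewrite !mxE; case: ifP => // ->. Qed.

Definition pr (P : pred 'M[entry]_m) : R :=
  (\sum_(M in diag_patterns) (P M)%:R) / #|diag_patterns|%:R.

Lemma card_diag_patterns_gt0 : 0 < #|diag_patterns|%:R :> R.
Proof. by rewrite ltr0n diag_patterns_gt0. Qed.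

Lemma pr_union (X : finType) (P : pred 'M[entry]_m) (Q : X -> pred 'M[entry]_m) :
  (forall M, M \in diag_patterns -> P M -> exists x, Q x M) ->
  pr P <= \sum_x pr (Q x).
Proof.
move=> PQ; rewrite /pr -mulr_suml exchange_big /=.
rewrite ler_pM2r ?invr_gt0 ?card_diag_patterns_gt0 //.
apply: ler_sum => M OM; case PM: (P M); last exact: sumr_ge0.
have [x Qx] := PQ _ OM PM.
by rewrite (bigD1 x) //= Qx lerDl sumr_ge0.
Qed.

Lemma pr_le (P Q : pred 'M[entry]_m) :
  (forall M, M \in diag_patterns -> P M -> Q M) -> pr P <= pr Q.
Proof.
move=> PQ; have := @pr_union unit P (fun=> Q).
by rewrite big_const /= card_unit /= addr0; apply=> M OM /(PQ _ OM); exists tt.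
Qed.

Lemma pr1 : pr predT = 1.
Proof.
by rewrite /pr sumr_const -[_ *+ _]/(_%:R) divff // gt_eqF ?card_diag_patterns_gt0.
Qed.

Lemma prN P : pr (predC P) = 1 - pr P.
Proof.
rewrite -pr1 /pr -mulrBl -sumrB; congr (_ / _); apply: eq_bigr => M _ /=.
by case: (P M); rewrite ?subrr ?subr0.
Qed.

(* [(M, N) |-> (resample B M N, resample B N M)] is an involution. *)
Lemma sum_resample A C (f : 'M[entry]_m -> R) :
  \sum_(M in diag_patterns) \sum_(N in diag_patterns) f (resample (cross A C) M N) =
  #|diag_patterns|%:R * \sum_(M in diag_patterns) f M.
Proof.
rewrite pair_big /=.
pose h (p : 'M[entry]_m * 'M[entry]_m) :=
  (resample (cross A C) p.1 p.2, resample (cross A C) p.2 p.1).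
have hK : involutive h by case=> M N; rewrite /h /= !resampleK.
rewrite (reindex_inj (inv_inj hK)) /=.
under eq_bigl => p.
  have -> : (resample (cross A C) p.1 p.2 \in diag_patterns) &&
    (resample (cross A C) p.2 p.1 \in diag_patterns) =
    (p.1 \in diag_patterns) && (p.2 \in diag_patterns).
    apply/andP/andP=> -[? ?]; split; try exact: resample_diag_patterns.
      by rewrite -(resampleK (cross A C) p.1 p.2) resample_diag_patterns.
    by rewrite -(resampleK (cross A C) p.2 p.1) resample_diag_patterns.
  over.
under eq_bigr do rewrite resampleK.
rewrite -(pair_big (mem diag_patterns) (mem diag_patterns) (fun M N => f M)) /=.
rewrite mulr_sumr; apply: eq_bigr => M _.
by rewrite sumr_const mulr_natl.
Qed.

(** By [sum_resample] the joint event can be averaged over independent [M] and [N]; [Q] is decided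
    by [M] alone and leaves the inner sum over [N]. *)
Lemma pr_cond A C (P Q : pred 'M[entry]_m) (rho : R) :
  (forall M N, M \in diag_patterns -> N \in diag_patterns ->
     Q (resample (cross A C) M N) = Q M) ->
  (forall M, M \in diag_patterns ->
     pr (fun N => P (resample (cross A C) M N)) <= rho) ->
  pr (predI P Q) <= rho * pr Q.
Proof.
move=> Qinv Prho; have c0 := card_diag_patterns_gt0.
rewrite /pr mulrA ler_pM2r ?invr_gt0 // -(ler_pM2l c0) -(sum_resample A C).
rewrite mulrA mulr_sumr; apply: ler_sum => M OM.
have := Prho M OM; rewrite /pr ler_pdivrMr // => le.
under eq_bigr => N ON do rewrite /= Qinv // -mulnb natrM.
by rewrite -mulr_suml ler_wpM2r // mulrC.
Qed.

Definition agree B W N := [forall p in B, W p.1 p.2 == N p.1 p.2].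

Lemma agreeP B W N :
  reflect (forall i j, (i, j) \in B -> W i j = N i j) (agree B W N).
Proof.
apply: (iffP forall_inP) => [H i j /H /eqP //|H [i j] /H /= ->//].
Qed.

Lemma pr_agree A C W : W \in diag_patterns ->
  (3 ^+ #|cross A C|)^-1 <= pr (agree (cross A C) W).
Proof.
move=> OW; set B := cross A C.
rewrite /pr ler_pdivlMr ?card_diag_patterns_gt0 // ler_pdivrMl ?exprn_gt0 //.
rewrite sum_indicator -natrX -natrM ler_nat; set S := [set M in _ | _].
(* [M] is recovered from its entries on [B] and from the pattern that carries [W] on [B] and [M]
   elsewhere; the latter lies in [S]. *)
pose h M : {ffun {x | x \in B} -> entry} * 'M[entry]_m :=
  ([ffun x => M (val x).1 (val x).2], resample B M W).
have hinj : injective h.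
  move=> M N [/ffunP eB /matrixP eO]; apply/matrixP => i j.
  have [ij|ij] := boolP ((i, j) \in B).
    by have := eB (exist _ (i, j) ij); rewrite !ffunE.
  by have := eO i j; rewrite !mxE (negbTE ij).
rewrite -(card_imset _ hinj).
have -> : (3 ^ #|B| * #|S| = #|finset.setX [set: {ffun {x | x \in B} -> entry}]%SET S|)%N.
  by rewrite cardsX cardsT card_ffun card_sig card_option card_bool.
apply/subset_leq_card/fintype.subsetP => _ /imsetP[M OM ->].
apply/finset.setXP; split; first exact: finset.in_setT.
apply/finset.setIdP; split; first exact: resample_diag_patterns.
by apply/agreeP => i j ij; rewrite mxE ij.
Qed.

(* [P t] is tested after every [P t'] with [wt t < wt t']: those do not look at
   the positions of [t], so given them [P t] still fails with probability at
   least 3^-b. *)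
Lemma pr_forall (F : finType) (A C : F -> {set 'I_m}) (b : nat) (wt : F -> nat)
    (P : F -> pred 'M[entry]_m) (D : {set F}) :
  injective wt ->
  (forall t, t \in D -> (#|cross (A t) (C t)| <= b)%N) ->
  (forall t M, t \in D -> M \in diag_patterns ->
     exists2 W, W \in diag_patterns & forall N, N \in diag_patterns ->
       agree (cross (A t) (C t)) W N -> ~~ P t (resample (cross (A t) (C t)) M N)) ->
  (forall t t' M N, t \in D -> t' \in D -> (wt t < wt t')%N ->
     M \in diag_patterns -> N \in diag_patterns ->
     P t' (resample (cross (A t) (C t)) M N) = P t' M) ->
  pr (fun M => [forall t in D, P t M]) <= (1 - (3 ^+ b)^-1) ^+ #|D|.
Proof.
move=> wt_inj; have [n] := ubnP #|D|; elim: n D => // n IH D leD Bb Pt Pt'.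
have [D0|[t0 t0D]] := set_0Vmem D.
  by rewrite D0 cards0 expr0 -pr1; apply: pr_le.
(* The test of least weight is split off: the remaining ones do not read its positions, so [pr_cond]
   applies. *)
have [t tD tmin] : exists2 t, t \in D & forall t', t' \in D -> (wt t <= wt t')%N.
  by case: (arg_minnP wt t0D) => t; exists t.
rewrite (cardsD1 t) tD exprS.
have D'D t' : t' \in (D :\ t)%SET -> t' \in D by rewrite in_setD1 => /andP[].
have le1 : 1 - (3 ^+ b)^-1 >= 0 :> R.
  by rewrite subr_ge0 invf_le1 ?exprn_gt0 // exprn_ege1 // ler1n.
apply: (@le_trans _ _ ((1 - (3 ^+ b)^-1) *
    pr (fun M => [forall s in (D :\ t)%SET, P s M]))); last first.
  apply: ler_wpM2l => //; apply: IH.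
  - by move: leD; rewrite (cardsD1 t) tD.
  - by move=> t' /D'D; exact: Bb.
  - by move=> t' M /D'D; exact: Pt.
  - by move=> t1 t2 M N /D'D ? /D'D ?; exact: Pt'.
apply: le_trans (pr_cond (A := A t) (C := C t) (P := P t) _ _).
- apply: pr_le => M OM /forall_inP PM; apply/andP; split; first exact: PM.
  by apply/forall_inP => t' /D'D /PM.
- move=> M N OM ON; apply: eq_forallb_in => t'.
  rewrite in_setD1 => /andP[tt' t'D]; apply: Pt' => //.
  rewrite ltn_neqAle tmin // andbT; apply: contra tt' => /eqP/wt_inj ->//.
- move=> M OM; have [W OW WP] := Pt t M tD OM.
  apply: (@le_trans _ _ (pr (predC (agree (cross (A t) (C t)) W)))).
    apply: pr_le => N ON /=; apply: contraTN; exact: WP.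
  rewrite prN lerD2l lerN2; apply: le_trans (pr_agree _ _ OW).
  by rewrite lef_pV2 ?posrE ?exprn_gt0 // ler_weXn2l ?ler1n // Bb.
Qed.

End RandomPattern.

(** * The random events *)

Section FrameEvents.
Variables (R : realType) (m : nat) (d : 'I_m -> bool).
Implicit Types (M N W : 'M[entry]_m).

Local Notation Om := (diag_patterns d).
Local Notation pr := (pr R d).
(** Bounds the probability of missing a prescribed value on at most [b] positions. *)
Local Notation miss b := (1 - (3 ^+ b)^-1 : R).

Lemma miss_ge0 b : 0 <= miss b.
Proof. by rewrite subr_ge0 invf_le1 ?exprn_gt0 // exprn_ege1 // ler1n. Qed.

Lemma miss_le1 b : miss b <= 1.
Proof. by rewrite gerBl invr_ge0 exprn_ge0. Qed.

Lemma miss_le b b' : (b <= b')%N -> miss b <= miss b'.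
Proof.
by move=> bb'; rewrite lerD2l lerN2 lef_pV2 ?posrE ?exprn_gt0 // ler_weXn2l ?ler1n.
Qed.

Lemma pr_resample (A C : {set 'I_m}) (P : pred 'M[entry]_m) (rho : R) :
  (forall M, M \in Om -> pr (fun N => P (resample (cross A C) M N)) <= rho) ->
  pr P <= rho.
Proof.
move=> Prho; have := pr_cond (Q := predT) (fun _ _ _ _ => erefl) Prho.
by rewrite pr1 mulr1; apply: le_trans; apply: pr_le => M _ /= ->.
Qed.

Variable T : role -> 'I_m.
Hypotheses (T_inj : injective T) (dT : forall r, d (T r) = role_diag r).

Definition role_set : {set 'I_m} := [set T r | r : role].

Lemma mem_role_set r : T r \in role_set.
Proof. exact: imset_f. Qed.

Lemma card_role_set : #|role_set| = 6%N.
Proof. by rewrite card_imset // card_sum card_prod !card_bool. Qed.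

(** One pattern realises both the entries among the six special classes and, at all other classes,
    the profiles of colour [c]; it is the witness for both kinds of event. *)
Definition frame_target (c : bool) : 'M[entry]_m :=
  sym_target d (fun i j =>
    match [pick r | T r == i], [pick r | T r == j] with
    | Some r, Some r' => role_pattern r r'
    | Some r, None | None, Some r => Some (profile r c)
    | None, None => e0
    end).

Lemma frame_target_diag_patterns c : frame_target c \in Om.
Proof.
apply: sym_target_diag_patterns => i j.
by case: pickP => [r _|_]; case: pickP => [r' _|_] //; rewrite role_patternC.
Qed.

Lemma pick_role r : [pick r' | T r' == T r] = Some r.
Proof. by case: pickP => [r' /eqP/T_inj->//|/(_ r)]; rewrite eqxx. Qed.

Lemma frame_target_role c r r' :
  r != r' -> frame_target c (T r) (T r') = role_pattern r r'.
Proof.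
move=> rr'; rewrite mxE (inj_eq T_inj) (negbTE rr') !pick_role !dT.
by case: r r' {rr'} => [b|[[] b]] [b'|[[] b']].
Qed.

Lemma frame_target_profile c r i :
  i \notin role_set -> frame_target c (T r) i = Some (profile r c).
Proof.
move=> iT; rewrite mxE pick_role; case: pickP => [r' /eqP e|_].
  by case/negP: iT; rewrite -e mem_role_set.
by rewrite ifN ?andbF //; apply: contraNneq iT => <-; exact: mem_role_set.
Qed.

Definition role_frame M :=
  [forall r, forall r', (r != r') ==> (M (T r) (T r') == role_pattern r r')].

Definition role_row M (c : bool) (i : 'I_m) :=
  [forall r, M (T r) i == Some (profile r c)].

Lemma role_frame_target c M N :
  agree (cross role_set role_set) (frame_target c) N ->
  role_frame (resample (cross role_set role_set) M N).
Proof.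
move=> /agreeP aN; apply/forallP => r; apply/forallP => r'; apply/implyP => rr'.
have in_rr' : (T r, T r') \in cross role_set role_set by rewrite in_cross !mem_role_set.
by rewrite mxE in_rr' -aN // frame_target_role.
Qed.

Lemma role_row_target c i M N : i \notin role_set ->
  agree (cross [set i] role_set) (frame_target c) N ->
  role_row (resample (cross [set i] role_set) M N) c i.
Proof.
move=> iT /agreeP aN; apply/forallP => r.
have in_ri : (T r, i) \in cross [set i] role_set.
  by rewrite in_cross mem_role_set finset.set11 orbT.
by rewrite mxE in_ri -aN // frame_target_profile.
Qed.

Variables (k : nat) (u : bool * 'I_k -> 'I_m).
Hypothesis u_inj : injective u.
Hypothesis uT : forall g, u g \notin role_set.

(** Resampling these positions leaves the rows of the special classes untouched. *)
Local Notation other := (cross (~: role_set) (~: role_set)).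

Definition stray M (x : role * 'I_m) :=
  (x.2 \notin role_set) &&
  [forall g, M x.2 (u g) != Some (~~ profile x.1 g.1)].

(** The entries between a fixed class and the members of [u] are independent, and each is the
    excluded value with probability at least [3 ^- 2]. At most one member equals that class, whence
    the predecessor in the exponent. *)
Lemma pr_stray M x : M \in Om ->
  pr (fun N => stray (resample other M N) x) <= miss 2 ^+ (2 * k).-1.
Proof.
move=> OM; case: x => r i; have [iT|iT] := boolP (i \in role_set).
  rewrite /stray /= iT /pr big1 ?mul0r ?exprn_ge0 ?miss_ge0 //.
pose D := [set g | u g != i].
apply: (@le_trans _ _ (miss 2 ^+ #|D|)); last first.
  apply: ler_wiXn2l; rewrite ?miss_ge0 ?miss_le1 //.
  have -> : D = ~: [set g | u g == i] by apply/finset.setP => g; rewrite !inE.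
  have le1 : (#|[set g | u g == i]| <= 1)%N.
    by apply/card_le1P => g; rewrite inE => /eqP ug g'; rewrite !inE -ug (inj_eq u_inj).
  have := cardsC [set g | u g == i]; rewrite card_prod card_bool card_ord.
  by move: le1; lia.
apply: le_trans (@pr_forall _ _ d _ (fun=> [set i]) (fun g => [set u g]) 2
  (fun g => enum_rank g)
  (fun g N => resample other M N i (u g) != Some (~~ profile r g.1)) D _ _ _ _).
- by apply: pr_le => N ON /andP[_ /forallP PN]; apply/forall_inP.
- by move=> g g' /val_inj/enum_rank_inj.
- by move=> g _; rewrite (leq_trans (card_cross _ _)) // !cards1.
- move=> g L; rewrite inE => gD OL.
  exists (sym_target d (fun _ _ => Some (~~ profile r g.1))).
    exact: sym_target_diag_patterns.
  move=> N ON /agreeP /(_ i (u g)); rewrite in_cross !inE !eqxx => /(_ isT).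
  rewrite mxE eq_sym (negbTE gD) andbF => aN.
  by rewrite negbK !mxE in_cross !inE iT (negbTE (uT _)) eqxx /= eqxx -aN.
- move=> g g' L N; rewrite !inE => gD g'D gg' OL ON.
  rewrite !mxE in_cross !inE iT (negbTE (uT _)) /= (inj_eq u_inj) (negbTE g'D) andbF orbF.
  by rewrite ifN // eqxx /=; apply: contraTneq gg' => ->; rewrite ltnn.
Qed.

(** Weaker than the condition on [phi] in [rigid_lists]: only entries between the two colours are
    compared, so that each such unordered pair of members has a unique index. *)
Definition preserves_edges M (phi : bool * 'I_k -> 'I_m) :=
  [forall p : 'I_k * 'I_k, M (phi (false, p.1)) (phi (true, p.2)) ==
                  M (u (false, p.1)) (u (true, p.2))].

Definition edge (phi : bool * 'I_k -> 'I_m) (p : 'I_k * 'I_k) : {set 'I_m} :=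
  [set phi (false, p.1); phi (true, p.2)].

Lemma edge_u_inj : injective (edge u).
Proof.
move=> [a b] [a' b'] /finset.setP e.
have := e (u (false, a)); have := e (u (true, b)).
rewrite !inE !(inj_eq u_inj) !eqxx orbT /=.
by rewrite /eq_op /= !orbF => /esym/eqP -> /esym/eqP ->.
Qed.

Lemma resample_edge phi p q L N : edge phi p != edge u q ->
  resample (cross [set u (false, q.1)] [set u (true, q.2)]) L N
    (phi (false, p.1)) (phi (true, p.2)) = L (phi (false, p.1)) (phi (true, p.2)).
Proof.
move=> ne; rewrite mxE ifN // in_cross !finset.in_set1; apply: contra ne.
by case/orP => /andP[/eqP e1 /eqP e2]; rewrite /edge e1 e2 // finset.setUC.
Qed.

Lemma resample_other_edge phi p q M L N : edge phi p != edge u q ->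
  resample other M
    (resample (cross [set u (false, q.1)] [set u (true, q.2)]) L N)
    (phi (false, p.1)) (phi (true, p.2)) =
  resample other M L (phi (false, p.1)) (phi (true, p.2)).
Proof. by move=> ne; rewrite mxE resample_edge // [RHS]mxE. Qed.

Lemma other_u M N g g' : resample other M N (u g) (u g') = N (u g) (u g').
Proof. by rewrite mxE in_cross !inE !(negbTE (uT _)). Qed.

(* The constraint of [p] equates the entries of [M] at [edge u p] and
   [edge phi p]; when the latter is heavier, revealing the heavy edges first
   makes the constraints successive independent conditions. *)
Lemma pr_preserves_edges_up M phi (wt : {set 'I_m} -> nat) : injective wt -> M \in Om ->
  pr (fun N => preserves_edges (resample other M N) phi) <=
  miss 2 ^+ #|[set p | (wt (edge u p) < wt (edge phi p))%N]|.
Proof.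
move=> wt_inj OM; set D := [set p | _].
apply: le_trans (@pr_forall _ _ d _ (fun p : 'I_k * 'I_k => [set u (false, p.1)])
  (fun p => [set u (true, p.2)]) 2 (fun p => wt (edge u p))
  (fun p N => resample other M N (phi (false, p.1)) (phi (true, p.2)) ==
     resample other M N (u (false, p.1)) (u (true, p.2))) D _ _ _ _).
- by apply: pr_le => N ON /forallP PN; apply/forall_inP.
- by move=> p q /wt_inj/edge_u_inj.
- by move=> p _; rewrite (leq_trans (card_cross _ _)) // !cards1.
- move=> p L; rewrite inE => pD OL.
  (* Redrawing the entry at [edge u p] does not change [c]. The target differs from [c] and is 0 or
     1, values that friendliness always permits. *)
  pose c := resample other M L (phi (false, p.1)) (phi (true, p.2)).
  exists (sym_target d (fun _ _ => if c == e0 then e1 else e0)).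
    exact: sym_target_diag_patterns.
  move=> N ON /agreeP /(_ (u (false, p.1)) (u (true, p.2))).
  rewrite in_cross !inE !eqxx => /(_ isT).
  rewrite mxE (inj_eq u_inj) /= => aN.
  have ne : edge phi p != edge u p by apply: contraTneq pD => ->; rewrite ltnn.
  rewrite other_u resample_other_edge // -/c.
  rewrite mxE in_cross !finset.in_set1 !eqxx /= -aN.
  by clear aN; clearbody c; case: c => [[]|]; rewrite /= ?andbF.
- move=> p q L N; rewrite !inE => pD qD pq OL ON.
  have ne : edge phi q != edge u p.
    by apply: contraTneq (ltn_trans pq qD) => ->; rewrite ltnn.
  have ne' : edge u q != edge u p by apply: contraTneq pq => ->; rewrite ltnn.
  by rewrite resample_other_edge // !other_u (resample_edge _ _ ne').
Qed.

(** An enumeration and its reverse both serve as weights, and each moved edge gets heavier in one of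
    them. A displaced member moves at least [k - 1 = 4 * h] of its edges; one factor 2 is lost as an
    edge has two ends, another in choosing the better order. *)
Lemma pr_preserves_edges M (phi : {ffun bool * 'I_k -> 'I_m}) h :
  k = (4 * h).+1 -> M \in Om ->
  pr (fun N => preserves_edges (resample other M N) phi) <=
  miss 2 ^+ (h * #|[set g | phi g != u g]|).
Proof.
move=> kh OM.
pose up := [set p | (enum_rank (edge u p) < enum_rank (edge phi p))%N].
pose down := [set p | (#|{set 'I_m}| - enum_rank (edge u p) <
                       #|{set 'I_m}| - enum_rank (edge phi p))%N].
have upP := pr_preserves_edges_up phi (wt := fun e => enum_rank e)
  (fun _ _ e => enum_rank_inj (val_inj e)) OM.
have downP := pr_preserves_edges_up phi
  (wt := fun e => (#|{set 'I_m}| - enum_rank e)%N) _ OM.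
suff /orP[hup|hdown] : (h * #|[set g | phi g != u g]| <= #|up|)%N ||
   (h * #|[set g | phi g != u g]| <= #|down|)%N.
- by apply: le_trans upP _; rewrite ler_wiXn2l ?miss_ge0 ?miss_le1.
- apply: le_trans (downP _) _; last by rewrite ler_wiXn2l ?miss_ge0 ?miss_le1.
  move=> e e' /eqP; rewrite eqn_sub2lE ?(ltnW (ltn_ord _)) // => /eqP.
  by move/val_inj/enum_rank_inj.
have moved : [set p | edge phi p != edge u p] \subset up :|: down.
  apply/fintype.subsetP => p; rewrite !inE => ne.
  have : enum_rank (edge phi p) != enum_rank (edge u p) :> nat.
    by apply: contra ne => /eqP/val_inj/enum_rank_inj ->.
  by rewrite neq_ltn => /orP[lt|->//]; rewrite ltn_sub2lE ?lt ?orbT // ltnW.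
have sum_pair (F : 'I_k * 'I_k -> nat) : (\sum_p F p = \sum_a \sum_b F (a, b))%N.
  by rewrite pair_bigA; apply: eq_bigr => -[].
have half c : (4 * h * #|[set a | phi (c, a) != u (c, a)]| <=
               #|[set p | edge phi p != edge u p]|)%N.
  pose sw (p : 'I_k * 'I_k) := if c then (p.2, p.1) else p.
  have swK : involutive sw by rewrite /sw; case: (c) => -[].
  rewrite -[X in (_ <= X)%N]sum1dep_card big_mkcond (reindex_inj (inv_inj swK)) /=.
  rewrite sum_pair.
  rewrite mulnC -sum_nat_const big_mkcond /=; apply: leq_sum => a _.
  rewrite inE; case: ifP => // ne.
  rewrite -big_mkcond sum1dep_card /=.
  (* An edge at a displaced member can stay in place only if [phi (c, a)] is the other end of that
     edge under [u], which happens for at most one [b]. *)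
  have le1 : (#|[set b | u (~~ c, b) == phi (c, a)]| <= 1)%N.
    apply/card_le1P => b; rewrite inE => /eqP ub b'; rewrite !inE -ub.
    by rewrite (inj_eq u_inj) xpair_eqE eqxx.
  have := cardsC [set b | u (~~ c, b) == phi (c, a)]; rewrite card_ord => eqk.
  apply: (@leq_trans #|~: [set b | u (~~ c, b) == phi (c, a)]|).
    by move: kh le1 eqk; lia.
  apply/subset_leq_card/fintype.subsetP => b; rewrite !inE; apply: contraNN.
  move=> /eqP/finset.setP/(_ (phi (c, a))); rewrite /sw !inE.
  by case: (c) ne => /= /negbTE ->; rewrite eqxx ?orbT ?orbF /= eq_sym => <-.
have total : #|[set g | phi g != u g]| =
  (#|[set a | phi (false, a) != u (false, a)]| +
   #|[set a | phi (true, a) != u (true, a)]|)%N.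
  rewrite -!sum1dep_card big_mkcond.
  rewrite [X in (X + _)%N]big_mkcond [X in (_ + X)%N]big_mkcond /=.
  rewrite addnC -(big_bool addn
    (fun c => \sum_a if phi (c, a) != u (c, a) then 1 else 0)%N).
  by rewrite pair_bigA; apply: eq_bigr => -[].
have := leq_trans (subset_leq_card moved) (leq_card_setU _ _).
rewrite total; move: (half false) (half true).
set x := #|_|; set y := #|_|; set z := #|_|; set v := #|_|; set w := #|_|.
rewrite -!mulnA mulnDr; move: (h * x)%N (h * y)%N => X Y; lia.
Qed.

Definition nonrigid M :=
  [exists phi : {ffun bool * 'I_k -> 'I_m}, (phi != finfun u) && preserves_edges M phi].

(** The sum factors over [g]: staying at [u g] contributes 1 and each of the [m.-1] other values
    contributes [rho]. *)
Lemma sum_displacement (rho : R) :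
  \sum_(phi : {ffun bool * 'I_k -> 'I_m}) rho ^+ #|[set g | phi g != u g]| =
  (1 + rho *+ m.-1) ^+ (2 * k).
Proof.
transitivity (\sum_(phi : {ffun bool * 'I_k -> 'I_m})
   \prod_g (if phi g != u g then rho else 1)).
  apply: eq_bigr => phi _; rewrite -big_mkcond prodr_const.
  by congr (_ ^+ _); apply: eq_card => g; rewrite inE.
rewrite -(bigA_distr_bigA (fun g i => if i != u g then rho else 1)).
under eq_bigr => g _.
  rewrite (bigD1 (u g)) //= eqxx /= (eq_bigr (fun=> rho)); last by move=> i ->.
  rewrite sumr_const cardC1 card_ord.
  over.
by rewrite prodr_const card_prod card_bool card_ord.
Qed.

(** Union bound over all maps; subtracting 1 removes the term of [u] itself. *)
Lemma pr_nonrigid M h : k = (4 * h).+1 -> M \in Om ->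
  pr (fun N => nonrigid (resample other M N)) <=
  (1 + (miss 2 ^+ h) *+ m.-1) ^+ (2 * k) - 1.
Proof.
move=> kh OM; apply: (@le_trans _ _ (\sum_(phi : {ffun bool * 'I_k -> 'I_m})
    pr (fun N => (phi != finfun u) && preserves_edges (resample other M N) phi))).
  by apply: pr_union => N ON /existsP[phi H]; exists phi.
rewrite -sum_displacement (bigD1 (finfun u)) //= [X in _ <= X - 1](bigD1 (finfun u)) //=.
rewrite (_ : [set _ | _] = finset.set0); last first.
  by apply/finset.setP => g; rewrite !inE ffunE eqxx.
rewrite cards0 expr0 [X in _ <= X]addrAC subrr add0r.
rewrite {1}/pr eqxx big1 // mul0r add0r; apply: ler_sum => phi _.
rewrite -exprM; apply: le_trans (pr_preserves_edges _ kh OM).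
by apply: pr_le => N ON /andP[].
Qed.

End FrameEvents.

(** * Disjoint candidates and the total failure probability *)

Section Candidates.
Variables (R : realType) (m : nat) (d : 'I_m -> bool) (k h : nat).
Implicit Types (M N W : 'M[entry]_m) (j : 'I_k).

Local Notation Om := (diag_patterns d).
Local Notation pr := (pr R d).
Local Notation miss b := (1 - (3 ^+ b)^-1 : R).

(** [zeros] supplies the classes p of [k] candidates and [2 * k] blocks of [k] classes, one block
    per member of U; [ones] supplies the classes q and s. *)
Variables (zeros : 'I_k * bool + (bool * 'I_k) * 'I_k -> 'I_m)
          (ones : 'I_k * (bool * bool) -> 'I_m).
Hypotheses (zeros_inj : injective zeros) (ones_inj : injective ones).
Hypotheses (dzeros : forall x, d (zeros x) = false).
Hypotheses (dones : forall x, d (ones x) = true).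
Hypothesis kh : k = (4 * h).+1.

Definition candidate j (r : role) : 'I_m :=
  match r with inl b => zeros (inl (j, b)) | inr c => ones (j, c) end.

Lemma zeros_neq_ones x y : zeros x <> ones y.
Proof. by move=> /(congr1 d); rewrite dzeros dones. Qed.

Lemma candidate_eq j j' r r' : candidate j r = candidate j' r' -> j = j' /\ r = r'.
Proof.
case: r r' => [b|c] [b'|c'] /=.
- by move/zeros_inj => [-> ->].
- by move/zeros_neq_ones.
- by move/esym/zeros_neq_ones.
- by move/ones_inj => [-> ->].
Qed.

Lemma candidate_inj j : injective (candidate j).
Proof. by move=> r r' /candidate_eq[]. Qed.

Lemma d_candidate j r : d (candidate j r) = role_diag r.
Proof. by case: r => [b|c] /=; rewrite ?dzeros ?dones. Qed.

(** The default [j] is merely some element of ['I_k], reached when the block of [g] has no suitable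
    class. *)
Definition selected M j (g : bool * 'I_k) : 'I_m :=
  zeros (inr (g, odflt j
    [pick t | role_row (candidate j) M g.1 (zeros (inr (g, t)))])).

Lemma zeros_notin_role_set j x : zeros (inr x) \notin role_set (candidate j).
Proof.
apply/negP => /imsetP[[b|c] _] /=; first by move/zeros_inj.
by move/zeros_neq_ones.
Qed.

Lemma selected_inj M j : injective (selected M j).
Proof. by move=> g g' /zeros_inj[]. Qed.

(** The selection reads only rows of special classes. Once these are fixed, so is U, and the bounds
    for a fixed [u] apply. *)
Lemma selected_resample M N j : let A := (~: role_set (candidate j))%SET in
  selected (resample (cross A A) M N) j = selected M j.
Proof.
apply/funext => g; rewrite /selected; congr (zeros (inr (g, odflt j _))).
apply: eq_pick => t; apply: eq_forallb => r.
by rewrite mxE in_cross !finset.in_setC mem_role_set.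
Qed.

Definition no_frame M := [forall j, ~~ role_frame (candidate j) M].

Definition no_row j M :=
  [exists g : bool * 'I_k, [forall t,
     ~~ role_row (candidate j) M g.1 (zeros (inr (g, t)))]].

Definition some_stray j M := [exists x, stray (candidate j) (selected M j) M x].

(** Distinct candidates are disjoint, so their frames read different entries; [72 = 2 * (6 * 6)]
    comes from [card_cross]. *)
Lemma pr_no_frame : pr no_frame <= miss 72 ^+ k.
Proof.
rewrite -[k in X in _ <= X]card_ord -cardsT.
apply: le_trans (@pr_forall R _ d _ (fun j => role_set (candidate j))
  (fun j => role_set (candidate j)) 72 (fun j => j)
  (fun j M => ~~ role_frame (candidate j) M) _ val_inj _ _ _).
- by apply: pr_le => M _ /forallP H; apply/forall_inP => j _; exact: H.
- by move=> j _; rewrite (leq_trans (card_cross _ _)) //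
    !(card_role_set (@candidate_inj j)).
- move=> j M _ OM; exists (frame_target d (candidate j) true).
    exact: frame_target_diag_patterns.
  move=> N ON aN; rewrite negbK.
  exact: (role_frame_target (@candidate_inj j) (d_candidate j) M aN).
- move=> j j' M N _ _ jj' OM ON; congr (~~ _).
  apply: eq_forallb => r; apply: eq_forallb => r'; congr (_ ==> _).
  rewrite mxE ifN // in_cross.
  suff nin s : candidate j' s \notin role_set (candidate j) by rewrite (negbTE (nin r)).
  apply: contraTN jj' => /imsetP[s' _ /candidate_eq[-> _]].
  by rewrite ltnn.
Qed.

(** Here [12 = 2 * (1 * 6)] bounds the positions between one class of a block and the special ones;
    the factor [2 * k] counts blocks. *)
Lemma pr_no_row j : pr (no_row j) <= miss 12 ^+ k *+ (2 * k).
Proof.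
apply: (@le_trans _ _ (\sum_(g : bool * 'I_k) pr (fun M => [forall t,
     ~~ role_row (candidate j) M g.1 (zeros (inr (g, t)))]))).
  by apply: pr_union => M OM /existsP.
rewrite (_ : (2 * k)%N = #|{: bool * 'I_k}|); last first.
  by rewrite card_prod card_bool card_ord.
rewrite -sumr_const; apply: ler_sum => g _.
rewrite -[k in X in _ <= X]card_ord -cardsT.
apply: le_trans (@pr_forall R _ d _ (fun t : 'I_k => [set zeros (inr (g, t))]%SET)
  (fun t => role_set (candidate j)) 12 (fun t => t)
  (fun t M => ~~ role_row (candidate j) M g.1 (zeros (inr (g, t)))) _ val_inj _ _ _).
- by apply: pr_le => M _ /forallP H; apply/forall_inP => t _; exact: H.
- by move=> t _; rewrite (leq_trans (card_cross _ _)) //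
    (card_role_set (@candidate_inj j)) cards1.
- move=> t M _ OM; exists (frame_target d (candidate j) g.1).
    exact: frame_target_diag_patterns.
  move=> N ON aN; rewrite negbK.
  apply: role_row_target aN; [exact: candidate_inj|exact: zeros_notin_role_set].
- move=> t t' M N _ _ tt' OM ON; congr (~~ _); apply: eq_forallb => r.
  rewrite mxE ifN // in_cross !finset.in_set1 (negbTE (zeros_notin_role_set _ _)) andbF.
  by apply: contraTN tt' => /andP[_ /eqP/zeros_inj[->]]; rewrite ltnn.
Qed.

Lemma pr_some_stray j : pr (some_stray j) <= miss 2 ^+ (2 * k).-1 *+ (6 * m).
Proof.
pose A := (~: role_set (candidate j))%SET; apply: (pr_resample (A := A) (C := A)) => M OM.
apply: (@le_trans _ _ (\sum_(x : role * 'I_m) pr (fun N =>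
    stray (candidate j) (selected M j) (resample (cross A A) M N) x))).
  by apply: pr_union => N ON /existsP[x]; rewrite selected_resample; exists x.
rewrite (_ : (6 * m)%N = #|{: role * 'I_m}|); last first.
  by rewrite card_prod card_sum card_prod card_bool card_ord.
rewrite -sumr_const; apply: ler_sum => x _.
apply: pr_stray OM => //; [exact: selected_inj|].
by move=> g; exact: zeros_notin_role_set.
Qed.

Lemma pr_selected_nonrigid j :
  pr (fun M => nonrigid (selected M j) M) <=
  (1 + (miss 2 ^+ h) *+ m.-1) ^+ (2 * k) - 1.
Proof.
pose A := (~: role_set (candidate j))%SET; apply: (pr_resample (A := A) (C := A)) => M OM.
under [X in pr X]eq_fun do rewrite selected_resample.
apply: pr_nonrigid kh OM.
- exact: selected_inj.
- by move=> g; exact: zeros_notin_role_set.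
Qed.

Lemma good_candidate j M : M \in Om -> role_frame (candidate j) M -> ~~ no_row j M ->
  ~~ some_stray j M -> ~~ nonrigid (selected M j) M ->
  infinitely_many_minimal_obstructions M.
Proof.
move=> OM frame rows strays rigid; have [sM dM fM] := diag_patternsP _ _ OM.
have := OM; rewrite inE => /and3P[symM frM _].
have k_gt0 : (0 < k)%N by rewrite kh.
have rowP r g : M (candidate j r) (selected M j g) = Some (profile r g.1).
  rewrite /selected; case: pickP => [t /forallP/(_ r)/eqP //|none].
  case/negP: rows; apply/existsP; exists g; apply/forallP => t.
  by have := none t; rewrite /= => ->.
apply: (@rigid_lists_infinite _ k M (candidate j) (selected M j)) => //.
- by move=> i; rewrite dM.
- split=> //.
  + by move=> r r' rr'; move: frame => /forallP/(_ r)/forallP/(_ r')/implyP/(_ rr')/eqP.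
  + by move=> r; rewrite dM d_candidate.
  + by move=> g; rewrite dM dzeros.
- split.
  + move=> r i compat; have /existsPn/(_ (r, i)) := strays.
    rewrite negb_and negbK /= => /orP[/imsetP[r' _ ->]|]; first by exists r'.
    case/negP; apply/forallP => g; apply/eqP; exact: compat.
  + move=> phi dphi Mphi g; have /existsPn/(_ (finfun phi)) := rigid.
    rewrite negb_and negbK => /orP[/eqP/ffunP/(_ g)|]; first by rewrite !ffunE.
    case/negP; apply/forallP => p; rewrite !ffunE; apply/eqP; exact: Mphi.
Qed.

(** Which candidate carries the frame depends on [M], so the three other failures are summed over
    all candidates; hence the final factor [k]. *)
Lemma pr_not_infinite :
  pr (fun M => ~~ `[< infinitely_many_minimal_obstructions M >]) <=
  miss 72 ^+ k + (miss 12 ^+ k *+ (2 * k) + (miss 2 ^+ (2 * k).-1 *+ (6 * m) +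
    ((1 + (miss 2 ^+ h) *+ m.-1) ^+ (2 * k) - 1))) *+ k.
Proof.
apply: (@le_trans _ _ (\sum_(x : unit + 'I_k) pr (fun M =>
    if x is inr j then
      [|| no_row j M, some_stray j M | nonrigid (selected M j) M]
    else no_frame M))).
  apply: pr_union => M OM /asboolPn inf.
  have [nf|/forallPn[j /negPn frame]] := boolP (no_frame M); first by exists (inl tt).
  exists (inr j); apply/negPn/negP; rewrite !negb_or => /and3P[? ? ?].
  by apply: inf; exact: (good_candidate (j := j)).
rewrite big_sumType /= big_const card_unit /= addr0 lerD ?pr_no_frame //.
have sumk (x : R) : x *+ k = \sum_(j < k) x by rewrite sumr_const card_ord.
rewrite sumk; apply: ler_sum => j _.
pose bad (i : 'I_3) : pred 'M[entry]_m :=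
  nth xpred0 [:: no_row j; some_stray j; fun M => nonrigid (selected M j) M] i.
apply: (@le_trans _ _ (\sum_(i < 3) pr (bad i))).
  apply: pr_union => M OM /or3P[] ?;
    [by exists 0|by exists 1|by exists (inord 2); rewrite /bad inordK].
rewrite !big_ord_recl big_ord0 addr0; apply: lerD; first exact: pr_no_row.
by apply: lerD; [exact: pr_some_stray|exact: pr_selected_nonrigid].
Qed.

End Candidates.

(** * The limit *)

Lemma embed_in_set (X T : finType) (A : {set T}) :
  (#|X| <= #|A|)%N -> exists f : X -> T, injective f /\ forall x, f x \in A.
Proof.
move=> le; exists (fun x => enum_val (widen_ord le (enum_rank x))).
split=> [x y /enum_val_inj /(congr1 val) /= /val_inj /enum_rank_inj //|x].
exact: enum_valP.
Qed.

Lemma bernoulli_ineq (R : realFieldType) (x : R) n :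
  -1 <= x -> 1 + x *+ n <= (1 + x) ^+ n.
Proof.
move=> x1; elim: n => [|n IH]; first by rewrite expr0 mulr0n addr0.
rewrite exprSr; apply: le_trans (ler_wpM2r _ IH); last by lra.
rewrite mulrS -mulr_natr; have : 0 <= n%:R :> R by [].
by move: (n%:R) => y y0; nra.
Qed.

(** In the induction the cross term [2 * x * (x *+ n)] is at most [x], because [x *+ n] is at most
    1/2. *)
Lemma bernoulli_upper (R : realFieldType) (x : R) n :
  0 <= x -> x *+ n <= 2^-1 -> (1 + x) ^+ n <= 1 + 2 * (x *+ n).
Proof.
move=> x0; elim: n => [|n IH] le; first by rewrite expr0 mulr0n mulr0 addr0.
move: le; rewrite mulrS => le.
have le' : x *+ n <= 2^-1 by lra.
rewrite exprSr; apply: le_trans (ler_wpM2r _ (IH le')) _; first by lra.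
have : 0 <= x *+ n by rewrite mulrn_wge0.
by move: (x *+ n) le le' => y *; nra.
Qed.

Lemma quartic_geometric (R : realType) (c e : R) : 0 < c -> c < 1 -> 0 < e ->
  exists H : nat, forall h, (H <= h)%N -> h.+2%:R ^+ 4 * c ^+ h <= e.
Proof.
move=> c0 c1 e0.
(* [c <= s ^+ 5], while [h.+2 * s ^+ h] stays bounded. *)
pose s := 1 - (1 - c) / 5.
have s0 : 0 < s by rewrite /s; lra.
have s1 : s < 1 by rewrite /s; lra.
have sc : c <= s ^+ 5.
  have := @bernoulli_ineq R (- ((1 - c) / 5)) 5; rewrite -/s => H.
  by apply: le_trans (H _); rewrite ?mulr_natr; lra.
pose dl := s^-1 - 1; have dl0 : 0 < dl by rewrite subr_gt0 invf_gt1.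
(* Chosen so that [h + 2 <= K * (1 + dl * h)], whose right side is at most [K / s ^+ h] by
   Bernoulli. *)
pose K := 2 + dl^-1; have K0 : 0 < K by rewrite addr_gt0 // invr_gt0.
have bK h : h.+2%:R * s ^+ h <= K.
  have := @bernoulli_ineq R dl h; rewrite [1 + dl]addrC subrK exprVn.
  move=> /(_ (ltW _)) H.
  have {}H : 1 + dl *+ h <= (s ^+ h)^-1 by apply: H; lra.
  rewrite -ler_pdivlMr ?exprn_gt0 //; apply: le_trans (ler_wpM2l (ltW K0) H).
  have -> : h.+2%:R = 2 + h%:R :> R by rewrite -natrD add2n.
  rewrite -[dl *+ h]mulr_natr /K; have : 0 <= h%:R :> R by [].
  move: (h%:R) => y y0; have : dl^-1 * dl = 1 by rewrite mulVf // gt_eqF.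
  have : 0 < dl^-1 by rewrite invr_gt0.
  by move: (dl^-1) => z; nra.
exists (Num.bound (K ^+ 5 / e)) => h Hh.
have h2 : 0 < h.+2%:R :> R by [].
(* Five bounded factors [h.+2%:R * s ^+ h] absorb the fourth power and leave a spare [h.+2] in the
   denominator. *)
apply: (@le_trans _ _ ((h.+2%:R * s ^+ h) ^+ 5 / h.+2%:R)).
  rewrite ler_pdivlMr // mulrAC -exprSr exprMn -exprM ler_pM2l ?exprn_gt0 //.
  by rewrite [(h * 5)%N]mulnC exprM lerXn2r // ?nnegrE ?exprn_ge0 // ltW.
rewrite ler_pdivrMr //; apply: (@le_trans _ _ (K ^+ 5)).
  by rewrite lerXn2r // ?nnegrE ?mulr_ge0 ?exprn_ge0 // ltW.
rewrite mulrC -ler_pdivrMr //.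
have := archi_boundP (divr_ge0 (exprn_ge0 5 (ltW K0)) (ltW e0)).
move=> /ltW /le_trans; apply; rewrite ler_nat; exact: leqW (leqW Hh).
Qed.

(** With [k = 4 * h + 1], the candidates and blocks use [2 * k + 2 * k ^ 2] classes of diagonal 0
    and [4 * k] of diagonal 1; both are at most [32 * h.+1 ^ 2]. *)
Lemma square_scale n : (32 <= n)%N ->
  exists h, (32 * h.+1 ^ 2 <= n < 32 * h.+2 ^ 2)%N.
Proof.
elim: n => // n IH; rewrite leq_eqVlt => /orP[/eqP <-|]; first by exists 0%N.
move=> /IH[h /andP[le lt]]; have [lt'|ge] := ltnP n.+1 (32 * h.+2 ^ 2).
  by exists h; rewrite lt' andbT (leq_trans le).
by exists h.+1; rewrite ge /=; move: lt; rewrite -!mulnn; lia.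
Qed.

(** The bound of [pr_not_infinite] at [k = 4 * h + 1], with the three values of [miss] as variables
    of which only the order matters. *)
Definition error_bound (R : realType) (a b c : R) (m h : nat) : R :=
  a ^+ (4 * h).+1 + (b ^+ (4 * h).+1 *+ (2 * (4 * h).+1) +
    (c ^+ (2 * (4 * h).+1).-1 *+ (6 * m) +
    ((1 + (c ^+ h) *+ m.-1) ^+ (2 * (4 * h).+1) - 1))) *+ (4 * h).+1.

(** Every power is at most [a ^+ h], while k is at most 4t and m at most 64t^2 for t = h + 2; the
    coefficients add up to at most 5665 t^4. The smallness hypothesis meets the condition of
    [bernoulli_upper]. *)
Lemma error_bound_le (R : realType) (a b c : R) n h :
  0 <= c -> c <= b -> b <= a -> a <= 1 -> (n < 32 * h.+2 ^ 2)%N ->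
  h.+2%:R ^+ 4 * a ^+ h <= 1024^-1 ->
  error_bound a b c (2 * n) h <= 8000 * (h.+2%:R ^+ 4 * a ^+ h).
Proof.
move=> c0 cb ba a1 nh small.
have hm : (2 * n <= 64 * h.+2 ^ 2)%N by clear -nh; move: nh; rewrite -!mulnn; lia.
have hk4 : ((4 * h).+1 <= 4 * h.+2)%N by clear; lia.
have hk : (h <= (4 * h).+1)%N by clear; lia.
have hk2 : (h <= (2 * (4 * h).+1).-1)%N by clear; lia.
rewrite /error_bound; move: (2 * n)%N (4 * h).+1 hm hk4 hk hk2 => m k hm hk4 hk hk2.
have powc x e : 0 <= x -> x <= a -> (h <= e)%N -> x ^+ e <= a ^+ h.
  move=> x0 xa he; apply: (@le_trans _ _ (x ^+ h)).
    by rewrite ler_wiXn2l // (le_trans xa).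
  by rewrite lerXn2r ?nnegrE // (le_trans x0).
have b0 := le_trans c0 cb; have a0 := le_trans b0 ba; have ca := le_trans cb ba.
have mM : m%:R <= 64 * h.+2%:R ^+ 2 :> R by move: hm; rewrite -(ler_nat R) natrM natrX.
have kM : k%:R <= 4 * h.+2%:R :> R by move: hk4; rewrite -(ler_nat R) natrM.
have hM : 1 <= h.+2%:R :> R by rewrite ler1n.
set t : R := h.+2%:R in small mM kM hM *; clearbody t.
have kR0 : 0 <= k%:R :> R by [].
have mR0 : 0 <= m%:R :> R by [].
have ch0 : 0 <= a ^+ h by rewrite exprn_ge0.
have kk : k%:R * k%:R <= 16 * t ^+ 4 :> R.
  apply: (@le_trans _ _ ((4 * t) * (4 * t))); first exact: ler_pM.
  rewrite (_ : 4 * t * (4 * t) = 16 * t ^+ 2); last by ring.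
  by apply: (ler_wpM2l (ler0n _ _)); exact: ler_weXn2l.
have km : k%:R * m%:R <= 256 * t ^+ 4 :> R.
  apply: (@le_trans _ _ ((4 * t) * (64 * t ^+ 2))); first exact: ler_pM.
  rewrite (_ : 4 * t * (64 * t ^+ 2) = 256 * t ^+ 3); last by ring.
  by apply: (ler_wpM2l (ler0n _ _)); exact: ler_weXn2l.
have kkm : k%:R * (k%:R * m%:R) <= 1024 * t ^+ 4 :> R.
  apply: (@le_trans _ _ ((4 * t) * ((4 * t) * (64 * t ^+ 2)))).
    by do 2?[apply: ler_pM; rewrite ?mulr_ge0 //].
  by rewrite (_ : 4 * t * (4 * t * (64 * t ^+ 2)) = 1024 * t ^+ 4) //; ring.
have rigid : (1 + (c ^+ h) *+ m.-1) ^+ (2 * k) - 1 <= 4 * k%:R * m%:R * a ^+ h.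
  have x0 : 0 <= c ^+ h *+ m.-1 by rewrite mulrn_wge0 // exprn_ge0.
  have xm : c ^+ h *+ m.-1 *+ (2 * k) <= 2 * (k%:R * m%:R) * a ^+ h.
    rewrite -mulrnA -[_ *+ _]mulr_natl; apply: ler_pM => //.
    - by rewrite exprn_ge0.
    - by rewrite -!natrM ler_nat mulnC -mulnA leq_pmul2l // leq_mul2l leq_pred orbT.
    - exact: powc.
  rewrite lerBlDl; apply: le_trans (bernoulli_upper x0 _) _.
    apply: le_trans xm _; apply: (@le_trans _ _ (512 * (t ^+ 4 * a ^+ h))); last by lra.
    by rewrite [_ * (_ * a ^+ h)]mulrA ler_wpM2r //; lra.
  by rewrite lerD2l; move: xm; lra.
have i1 := powc a k a0 (lexx a) hk.
have i2 : b ^+ k *+ (2 * k) <= 2 * k%:R * a ^+ h.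
  by rewrite -[_ *+ _]mulr_natl natrM;
    apply: ler_wpM2l (powc b k b0 ba hk); rewrite mulr_ge0.
have i3 : c ^+ (2 * k).-1 *+ (6 * m) <= 6 * m%:R * a ^+ h.
  by rewrite -[_ *+ _]mulr_natl natrM;
    apply: ler_wpM2l (powc c _ c0 ca hk2); rewrite mulr_ge0.
rewrite -[_ *+ k]mulr_natr.
apply: (@le_trans _ _ (a ^+ h + (2 * k%:R * a ^+ h + (6 * m%:R * a ^+ h +
    4 * k%:R * m%:R * a ^+ h)) * k%:R)).
  by apply: lerD => //; apply: ler_wpM2r => //; apply: lerD => //; exact: lerD.
have t1 : 1 <= t ^+ 4 by exact: exprn_ege1.
rewrite [X in X <= _](_ : _ = (1 + 2 * (k%:R * k%:R) + 6 * (k%:R * m%:R) +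
    4 * (k%:R * (k%:R * m%:R))) * a ^+ h); last by ring.
by rewrite [X in _ <= X]mulrA ler_wpM2r //; lra.
Qed.

Lemma error_bound_small (R : realType) (a b c e : R) :
  0 <= c -> c <= b -> b <= a -> 0 < a -> a < 1 -> 0 < e ->
  exists H, forall h n, (H <= h)%N -> (n < 32 * h.+2 ^ 2)%N ->
    error_bound a b c (2 * n) h <= e.
Proof.
move=> c0 cb ba a0 a1 e0.
have d0 : 0 < Num.min 1024^-1 (e / 8000) by rewrite lt_min; apply/andP; split; lra.
have [H HP] := quartic_geometric a0 a1 d0.
exists H => h n Hh nh; have := HP h Hh; rewrite le_min => /andP[small1 small2].
apply: le_trans (error_bound_le c0 cb ba (ltW a1) nh small1) _.
by move: (_ ^+ 4 * _) small2 => x; lra.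
Qed.

(** * Averaging over balanced diagonals *)

Section RandomDiagonal.
Variable R : realType.
Local Notation miss b := (1 - (3 ^+ b)^-1 : R).

Lemma sum_bad_diag_patterns n h (d : 'I_(2 * n) -> bool) :
  (32 * h.+1 ^ 2 <= n)%N ->
  #|[set i | ~~ d i]| = n -> #|[set i | d i]| = n ->
  \sum_(M in diag_patterns d) (~~ `[< infinitely_many_minimal_obstructions M >])%:R
    <= error_bound (miss 72) (miss 12) (miss 2) (2 * n) h * #|diag_patterns d|%:R.
Proof.
move=> hn d0 d1; set k := (4 * h).+1.
have [|zeros [zeros_inj zerosP]] :=
  @embed_in_set ('I_k * bool + (bool * 'I_k) * 'I_k)%type _ [set i | ~~ d i].
  rewrite d0 card_sum !card_prod card_bool card_ord /k; move: hn; rewrite -!mulnn; lia.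
have [|ones [ones_inj onesP]] :=
  @embed_in_set ('I_k * (bool * bool))%type _ [set i | d i].
  rewrite d1 !card_prod card_bool card_ord /k; move: hn; rewrite -!mulnn; lia.
rewrite -ler_pdivrMr ?card_diag_patterns_gt0 //.
apply: (pr_not_infinite R zeros_inj ones_inj) => // x.
  by have := zerosP x; rewrite inE => /negbTE.
by have := onesP x; rewrite inE.
Qed.

Lemma friendly_patterns_diag n (M : 'M[entry]_(2 * n)) :
  M \in friendly_patterns n -> M \in diag_patterns (fun i => M i i == e1).
Proof.
rewrite inE => /and4P[sM fM /eqP c0 /eqP c1]; rewrite inE sM fM /=.
have c01 : [set i | M i i == e0] :|: [set i | M i i == e1] = [set: 'I_(2 * n)].
  apply/eqP; rewrite eqEcard finset.subsetT /= cardsU cardsT card_ord.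
  rewrite (_ : _ :&: _ = finset.set0) ?cards0; last first.
    by apply/finset.setP => i; rewrite !inE; case: (M i i) => [[]|].
  by move: c0 c1; rewrite /diag_count => -> ->; rewrite subn0 mul2n addnn.
apply/forallP => i; have /finset.setP/(_ i) := c01.
by rewrite !inE; case: (M i i) => [[]|].
Qed.

Lemma diag_patterns_friendly n (d : 'I_(2 * n) -> bool) (M : 'M[entry]_(2 * n)) :
  #|[set i | ~~ d i]| = n -> #|[set i | d i]| = n ->
  M \in diag_patterns d -> M \in friendly_patterns n.
Proof.
move=> d0 d1; rewrite !inE => /and3P[-> -> /forallP dM] /=; rewrite /diag_count.
apply/andP; split; apply/eqP; [rewrite -[RHS]d0|rewrite -[RHS]d1];
  by apply: eq_card => i; rewrite !inE (eqP (dM i)); case: (d i).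
Qed.

Lemma friendly_patterns_gt0 n : (0 < #|friendly_patterns n|)%N.
Proof.
pose d (i : 'I_(2 * n)) := (n <= i)%N.
have le : (n <= 2 * n)%N by lia.
have d0 : #|[set i | ~~ d i]| = n.
  have inj : injective (widen_ord le) by move=> i j /(congr1 val) /= /val_inj.
  rewrite -[RHS]card_ord -(card_imset _ inj).
  apply: eq_card => i; rewrite !inE -ltnNge; apply/idP/imsetP => [lt|[j _ ->]] /=.
    by exists (Ordinal lt) => //; exact: val_inj.
  exact: ltn_ord.
have d1 : #|[set i | d i]| = n.
  have := cardsC [set i | d i]; rewrite card_ord.
  rewrite (_ : ~: _ = [set i | ~~ d i]) ?d0; last by apply/finset.setP => i; rewrite !inE.
  by move=> e; move: (#|_|) e => x; lia.
have [M OM] := card_gt0P (diag_patterns_gt0 d).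
by apply/card_gt0P; exists M; exact: (diag_patterns_friendly d0 d1).
Qed.

(** Sorting patterns by their diagonal splits the sum into sets [diag_patterns d] with [d] balanced,
    on each of which the same bound holds. *)
Lemma sum_bad_friendly_patterns n h : (32 * h.+1 ^ 2 <= n)%N ->
  \sum_(M in friendly_patterns n)
     (~~ `[< infinitely_many_minimal_obstructions M >])%:R
    <= error_bound (miss 72) (miss 12) (miss 2) (2 * n) h * #|friendly_patterns n|%:R.
Proof.
move=> hn; pose key (M : 'M[entry]_(2 * n)) := [ffun i => M i i == e1].
rewrite -sum1_card natr_sum mulr_sumr.
rewrite (partition_big key xpredT) //= [X in _ <= X](partition_big key xpredT) //=.
apply: ler_sum => d _.
have [M0 /andP[FM0 /eqP kM0]|none] :=
  pickP (fun M => (M \in friendly_patterns n) && (key M == d)); last first.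
  by rewrite !big_pred0.
have keyE M : key M = d -> (fun i => M i i == e1) = d.
  by move=> <-; apply/funext => i; rewrite ffunE.
have OM0 := friendly_patterns_diag FM0; rewrite (keyE _ kM0) in OM0.
have [_ dM0 _] := diag_patternsP _ _ OM0.
have := FM0; rewrite inE => /and4P[_ _ /eqP c0 /eqP c1].
have d0 : #|[set i | ~~ d i]| = n.
  by rewrite -[RHS]c0; apply: eq_card => i; rewrite !inE dM0; case: (d i).
have d1 : #|[set i | d i]| = n.
  by rewrite -[RHS]c1; apply: eq_card => i; rewrite !inE dM0; case: (d i).
have eqd M : (M \in friendly_patterns n) && (key M == d) = (M \in diag_patterns d).
  apply/andP/idP => [[FM /eqP/keyE <-]|OM]; first exact: friendly_patterns_diag.
  split; first exact: (diag_patterns_friendly d0 d1).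
  have [_ dM _] := diag_patternsP _ _ OM.
  by apply/eqP/ffunP => i; rewrite ffunE dM; case: (d i).
rewrite !(eq_bigl _ _ eqd) -mulr_sumr.
have -> : \sum_(M in diag_patterns d) 1%:R = #|diag_patterns d|%:R :> R.
  by rewrite -sum1_card natr_sum.
exact: sum_bad_diag_patterns.
Qed.

Lemma uniform_probability_bad n h : (32 * h.+1 ^ 2 <= n)%N ->
  `|1 - uniform_probability R (friendly_patterns n)
       (fun M : 'M[entry]_(2 * n) => infinitely_many_minimal_obstructions M)|
    <= error_bound (miss 72) (miss 12) (miss 2) (2 * n) h.
Proof.
move=> hn; have FP0 : 0 < #|friendly_patterns n|%:R :> R.
  by rewrite ltr0n friendly_patterns_gt0.
rewrite /uniform_probability.
have -> : 1 - #|[set M in friendly_patterns n |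
      `[< infinitely_many_minimal_obstructions M >]]|%:R / #|friendly_patterns n|%:R =
    (\sum_(M in friendly_patterns n)
      (~~ `[< infinitely_many_minimal_obstructions M >])%:R) /
    #|friendly_patterns n|%:R :> R.
  have FP_neq0 : #|friendly_patterns n|%:R != 0 :> R by rewrite gt_eqF.
  rewrite -{1}(divff FP_neq0) -mulrBl; congr (_ / _).
  rewrite -(sum_indicator R) -sum1_card natr_sum -sumrB; apply: eq_bigr => M _.
  by case: `[< _ >]; rewrite ?subrr ?subr0.
rewrite ger0_norm ?divr_ge0 ?sumr_ge0 // ler_pdivrMr //.
exact: sum_bad_friendly_patterns.
Qed.

End RandomDiagonal.

Local Open Scope classical_set_scope.

Theorem theorem1 (R : realType) :
  (fun n : nat =>
     uniform_probability R (friendly_patterns n)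
       (fun M : 'M[entry]_(2 * n) => infinitely_many_minimal_obstructions M))
    @ \oo --> (1 : R).
Proof.
apply/cvgrPdist_le => e e0.
have [c12 c72] : 1 - (3 ^+ 2)^-1 <= 1 - (3 ^+ 12)^-1 :> R /\
    1 - (3 ^+ 12)^-1 <= 1 - (3 ^+ 72)^-1 :> R.
  by split; exact: miss_le.
have c0 : 0 < 1 - (3 ^+ 72)^-1 :> R.
  by rewrite subr_gt0 invf_lt1 ?exprn_gt0 // exprn_egt1 // ltr1n.
have c1 : 1 - (3 ^+ 72)^-1 < 1 :> R by rewrite gtrBl invr_gt0 exprn_gt0.
have [H HP] := error_bound_small (miss_ge0 R 2) c12 c72 c0 c1 e0.
(* Beyond this threshold the scale [h] of [n] is at least [H], since
   [32 * H.+1 ^ 2 <= n < 32 * h.+2 ^ 2]. *)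
exists (32 * H.+1 ^ 2)%N => // n /= Hn.
have [|h /andP[hn nh]] := @square_scale n.
  by apply: leq_trans Hn; rewrite leq_pmulr // expn_gt0.
have Hh : (H <= h)%N.
  by have := leq_ltn_trans Hn nh; rewrite ltn_mul2l ltn_exp2r.
exact: le_trans (uniform_probability_bad R hn) (HP h n Hh nh).
Qed.
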